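(* Let $A$ and $B$ be finite nontrivial (additive) abelian groups, let $I$ be a finite set with $|I|>1$, let $\varphi_1\colon A\to B$ be a map of sets such that $\varphi_1(-a)=\varphi_1(a)$ for all $a\in A$, and let $\varphi_2\colon B\to A$ be a group homomorphism. Let $(X(A,B,I),r)$ be the solution of the YBE on $X(A,B,I)=A\times B\times I$ given by $$r((a,b,i),(c,d,j))=\bigl(\sigma_{(a,b,i)}(c,d,j),\ \sigma^{-1}_{\sigma_{(a,b,i)}(c,d,j)}(a,b,i)\bigr),$$ $$\sigma_{(a,b,i)}(c,d,j)=\begin{cases}(c,d+\varphi_1(a-c),j)&\text{if } i=j,\\ (c+\varphi_2(b),d,j)&\text{if } i\neq j.\end{cases}$$ If $\varphi_1(0)=0$, $\varphi_1(A)$ generates $B$, and $\varphi_2$ is an isomorphism, then the structure group $G(X(A,B,I),r)$ is not a poly-(infinite cyclic) group.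
   Context: A solution of the YBE is a pair $(X,r)$ where $X$ is a non-empty set and $r\colon X\times X\to X\times X$, $r(x,y)=(\sigma_x(y),\gamma_y(x))$, satisfies: $r^2=\mathrm{id}$; $\sigma_x,\gamma_x\in\operatorname{Sym}(X)$ for all $x\in X$; and $r_{12}r_{23}r_{12}=r_{23}r_{12}r_{23}$ on $X^3$, where $r_{ij}$ acts as $r$ on the $(i,j)$ components and as the identity on the remaining one. (It is known that the pair $(X(A,B,I),r)$ in the claim is a solution of the YBE.) The structure group of $(X,r)$ is the group $G(X,r)=\langle X\mid xy=zt \text{ whenever } r(x,y)=(z,t)\rangle$. A group $G$ is poly-(infinite cyclic) if it has a finite subnormal series $\{1\}=G_0\trianglelefteq G_1\trianglelefteq\cdots\trianglelefteq G_m=G$ with each quotient $G_{i}/G_{i-1}$ infinite cyclic. *)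

(* Defs.v *)
From HB Require Import structures.
From mathcomp Require Import all_boot all_order all_algebra all_fingroup.
From mathcomp Require Import boolp classical_sets cardinality.

Set Implicit Arguments.
Unset Strict Implicit.
Unset Printing Implicit Defensive.

Import GRing.Theory.

Section YangBaxter.
Variable X : Type.
Implicit Types r : X * X -> X * X.

Definition r12 r (t : X * X * X) : X * X * X :=
  let: (x, y, z) := t in (r (x, y), z).

Definition r23 r (t : X * X * X) : X * X * X :=
  let: (x, y, z) := t in let: (y', z') := r (y, z) in (x, y', z').

(* [sigma_x] is [fun y => (r (x, y)).1] and [gamma_x] is
   [fun y => (r (y, x)).2]. *)
Record is_ybe_solution r : Prop := IsYbeSolution {
  ybe_involutive : involutive r;
  ybe_left_bij : forall x, bijective (fun y => (r (x, y)).1);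
  ybe_right_bij : forall x, bijective (fun y => (r (y, x)).2);
  ybe_braid : r12 r \o r23 r \o r12 r =1 r23 r \o r12 r \o r23 r
}.

End YangBaxter.

Section Presentation.
Variable X : choiceType.

(* Words in the alphabet X u X^-1: (x, false) stands for x and (x, true) for
   its formal inverse. *)
Definition word : choiceType := seq (X * bool).
Definition letter_inv (l : X * bool) : X * bool := (l.1, ~~ l.2).
Definition word_inv (w : word) : word := rev (map letter_inv w).

Variable rels : word -> word -> Prop.

Inductive pres_eq : word -> word -> Prop :=
| pres_rel u v of rels u v : pres_eq u v
| pres_cancel l : pres_eq [:: l; letter_inv l] [::]
| pres_cat u u' v v' of pres_eq u u' & pres_eq v v' :
    pres_eq (u ++ v) (u' ++ v')
| pres_refl u : pres_eq u u
| pres_sym u v of pres_eq u v : pres_eq v u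
| pres_trans u v w of pres_eq u v & pres_eq v w : pres_eq u w.

Definition pres_eqb (u v : word) : bool := `[< pres_eq u v >].

Lemma pres_eqb_equiv : equiv_class_of pres_eqb.
Proof.
split=> [u|u v|v u w].
- exact/asboolP/pres_refl.
- by apply/asboolP/asboolP => /pres_sym.
- by move=> /asboolP uv /asboolP vw; apply/asboolP/(pres_trans uv).
Qed.

Canonical pres_equiv_rel : equiv_rel word := EquivRelPack pres_eqb_equiv.

Definition presented_group := {eq_quot pres_equiv_rel}%qT.

HB.instance Definition _ := Choice.on presented_group.
HB.instance Definition _ := EqQuotient.on presented_group.

Local Open Scope quotient_scope.

Definition pres_mul (g h : presented_group) : presented_group :=
  \pi_presented_group (generic_quotient.repr g ++ generic_quotient.repr h).
Definition pres_one : presented_group := \pi_presented_group [::].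
Definition pres_inv (g : presented_group) : presented_group :=
  \pi_presented_group (word_inv (generic_quotient.repr g)).

Lemma pres_piP (u v : word) :
  \pi_presented_group u = \pi_presented_group v <-> pres_eq u v.
Proof.
split=> [/eqmodP/asboolP//|uv]; exact/eqmodP/asboolP.
Qed.

Lemma repr_piP (u : word) : pres_eq (generic_quotient.repr (\pi_presented_group u)) u.
Proof. by apply/pres_piP; rewrite reprK. Qed.

Lemma letter_invK : involutive letter_inv.
Proof. by case=> x b; rewrite /letter_inv negbK. Qed.

Lemma word_invK : involutive word_inv.
Proof.
by move=> w; rewrite /word_inv map_rev revK -map_comp map_id_in // => l _;
   exact: letter_invK.
Qed.

Lemma pres_mulwV (w : word) : pres_eq (w ++ word_inv w) [::].
Proof.
elim: w => [|l w IHw]; first exact: pres_refl.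
have -> : (l :: w) ++ word_inv (l :: w) =
          [:: l] ++ ((w ++ word_inv w) ++ [:: letter_inv l]).
  by rewrite /word_inv /= rev_cons -cats1 catA.
apply: pres_trans (pres_cancel l); rewrite -[X in pres_eq _ X]cat1s.
by apply: (pres_cat (pres_refl _)); apply: pres_cat IHw (pres_refl _).
Qed.

Lemma pres_mulVw (w : word) : pres_eq (word_inv w ++ w) [::].
Proof. by rewrite -[X in _ ++ X]word_invK; exact: pres_mulwV. Qed.

Lemma pres_mulgA : associative pres_mul.
Proof.
move=> g h k; apply/pres_piP.
apply: pres_trans (pres_cat (pres_refl _) (repr_piP _)) _.
rewrite catA; apply: pres_cat; last exact: pres_refl.
exact/pres_sym/repr_piP.
Qed.

Lemma pres_mul1g : left_id pres_one pres_mul.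
Proof.
move=> g; rewrite -[RHS]reprK; apply/pres_piP.
by rewrite -[X in pres_eq _ X]cat0s; apply: pres_cat (repr_piP _) (pres_refl _).
Qed.

Lemma pres_mulg1 : right_id pres_one pres_mul.
Proof.
move=> g; rewrite -[RHS]reprK; apply/pres_piP.
by rewrite -[X in pres_eq _ X]cats0; apply: pres_cat (pres_refl _) (repr_piP _).
Qed.

Lemma pres_mulVg : left_inverse pres_one pres_inv pres_mul.
Proof.
move=> g; apply/pres_piP.
apply: pres_trans (pres_mulVw (generic_quotient.repr g)).
exact: pres_cat (repr_piP _) (pres_refl _).
Qed.

Lemma pres_mulgV : right_inverse pres_one pres_inv pres_mul.
Proof.
move=> g; apply/pres_piP.
apply: pres_trans (pres_mulwV (generic_quotient.repr g)).
exact: pres_cat (pres_refl _) (repr_piP _).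
Qed.

HB.instance Definition _ := isGroup.Build presented_group
  pres_mulgA pres_mul1g pres_mulg1 pres_mulVg pres_mulgV.

End Presentation.

Section StructureGroup.
Variables (X : choiceType) (r : X * X -> X * X).

Inductive structure_rel : word X -> word X -> Prop :=
| StructureRel x y z t of r (x, y) = (z, t) :
    structure_rel [:: (x, false); (y, false)] [:: (z, false); (t, false)].

Definition structure_group : groupType := presented_group structure_rel.

End StructureGroup.

Section PolyInfiniteCyclic.
Variable G : groupType.
Implicit Types (x g h k : G) (H K : set G).
Local Open Scope group_scope.
Local Open Scope classical_set_scope.

Definition is_subgroup H : Prop := group_closed (mem H).

Definition is_normal H K : Prop :=
  H `<=` K /\ (forall h k, H h -> K k -> H (h ^ k)).

Definition left_coset H x : set G := [set x * h | h in H].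

Definition coset_space K H : set (set G) := [set left_coset H x | x in K].

(* K / H is infinite and generated by a coset gH, whose powers are the
   (gH)^n = g^n H with n an integer. *)
Definition infinite_cyclic_quotient K H : Prop :=
  infinite_set (coset_space K H) /\
  exists2 g, K g &
    forall C, coset_space K H C ->
      exists n : nat, C = left_coset H (g ^+ n) \/ C = left_coset H (g ^- n).

Definition poly_infinite_cyclic : Prop :=
  exists (m : nat) (S : nat -> set G),
    [/\ S 0%N = [set 1], S m = [set: G],
        forall i, (i <= m)%N -> is_subgroup (S i) &
        forall i, (i < m)%N ->
          is_normal (S i) (S i.+1) /\ infinite_cyclic_quotient (S i.+1) (S i)].

End PolyInfiniteCyclic.

Section SolutionXABI.
Variables (A B : finZmodType) (I : finType).
Variables (phi1 : A -> B) (phi2 : B -> A).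
Local Open Scope ring_scope.

Definition XABI : finType := (A * B * I)%type.

Definition sigma_fun (x y : XABI) : XABI :=
  let: (a, b, i) := x in
  let: (c, d, j) := y in
  if i == j then (c, d + phi1 (a - c), j) else (c + phi2 b, d, j).

Lemma sigma_fun_inj x : injective (sigma_fun x).
Proof.
case: x => [[a b] i] [[c d] j] [[c' d'] j'] /=.
case: eqP => [<-|ij]; case: eqP => [<-|ij'].
- by case=> -> /addIr ->.
- by case=> _ _ e; case: ij'.
- by case=> _ _ e; case: ij.
- by case=> /addIr -> -> ->.
Qed.

Definition sigma (x : XABI) : {perm XABI} := perm (@sigma_fun_inj x).

Definition r_ABI (p : XABI * XABI) : XABI * XABI :=
  let: (x, y) := p in (sigma x y, ((sigma (sigma x y))^-1)%g x).

End SolutionXABI.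

Section SolutionXABITheory.
Variables (A B : finZmodType) (I : finType).
Variables (phi1 : A -> B) (phi2 : {additive B -> A}).
Hypothesis phi1_even : forall a, phi1 (- a)%R = phi1 a.
Local Open Scope ring_scope.
Local Notation X := (XABI A B I).
Local Notation s := (@sigma A B I phi1 phi2).
Local Notation r := (@r_ABI A B I phi1 phi2).

Let gamma_fun (y x : X) : X :=
  let: (a, b, i) := x in
  let: (c, d, j) := y in
  if i == j then (a, b - phi1 (a - c), i) else (a - phi2 d, b, i).

Let phi1B a c : phi1 (a - c) = phi1 (c - a).
Proof. by rewrite -phi1_even opprB. Qed.

Let gammaE x y : ((s (s x y))^-1)%g x = gamma_fun y x.
Proof.
apply: (@perm_inj _ (s (s x y))); rewrite permKV !permE.
case: x y => [[a b] i] [[c d] j] /=.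
have [<-|ij] := eqVneq i j; rewrite /= ?eqxx.
  by rewrite (phi1B c a) subrK.
by rewrite eq_sym (negPf ij) subrK.
Qed.

Let rE x y : r (x, y) = (s x y, gamma_fun y x).
Proof. by rewrite /r_ABI gammaE. Qed.

Let s_gamma x y : s (s x y) (gamma_fun y x) = x.
Proof. by rewrite -gammaE permKV. Qed.

Let sM x y t : s (s x y) (s (gamma_fun y x) t) = s x (s y t).
Proof.
rewrite !permE.
case: x y t => [[a b] i] [[c d] j] [[e f] k] /=.
have [<-|ij] /= := eqVneq i j.
  have [<-|ik] /= := eqVneq i k; rewrite ?eqxx ?(negPf ik) /=.
    by rewrite addrAC.
  rewrite (phi1B a c) -!addrA -!raddfD /=.
    by rewrite (addrC d (phi1 _)) addrA subrK (addrC b).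
have [<-|ik] /= := eqVneq i k; rewrite ?eqxx ?(negPf ij) /=.
  by rewrite eq_sym (negPf ij) /= eqxx opprD (addrC (- e)) addrA.
have [<-|jk] /= := eqVneq j k; rewrite ?eqxx ?(negPf ij) ?(negPf ik) /=.
  by rewrite opprD addrACA subrr addr0.
by rewrite addrAC.
Qed.

Let Pi3 (t : X * X * X) := let: (x, y, z) := t in (x, s x y, s x (s y z)).

Let Pi3_inj : injective Pi3.
Proof.
move=> [[x y] z] [[x' y'] z'] [<- /perm_inj <-].
by move=> /perm_inj/perm_inj <-.
Qed.

Let Pi3_r12 t : Pi3 (r12 r t) = let: (x, y, z) := Pi3 t in (y, x, z).
Proof. by case: t => [[x y] z]; rewrite /r12 rE /Pi3 s_gamma sM. Qed.

Let Pi3_r23 t : Pi3 (r23 r t) = let: (x, y, z) := Pi3 t in (x, z, y).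
Proof. by case: t => [[x y] z]; rewrite /r23 rE /Pi3 s_gamma. Qed.

Theorem r_ABI_solution : is_ybe_solution r.
Proof.
split.
- by move=> [x y]; rewrite rE /r_ABI s_gamma permK.
- by move=> x; apply: injF_bij => y y' /= /perm_inj.
- move=> x; apply: injF_bij => y y'; rewrite !rE /=.
  case: x y y' => [[c d] j] [[a b] i] [[a' b'] i'] /=.
  case: eqP => [->|ij]; case: eqP => [->|ij'].
  + by case=> -> /addIr ->.
  + by case=> _ _ e; case: ij'.
  + by case=> _ _ e; case: ij.
  + by case=> /addIr -> -> ->.
- move=> t; apply: Pi3_inj; rewrite /= !(Pi3_r12, Pi3_r23).
  by case: (Pi3 t) => [[x y] z].
Qed.

End SolutionXABITheory.

(* Main.v *)
Require Import Defs.
From mathcomp Require Import all_boot all_order all_algebra all_fingroup.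
From mathcomp Require Import boolp classical_sets cardinality.
From mathcomp Require Import cyclic.
From mathcomp Require Import monoid.

(** A poly-(infinite cyclic) group is locally indicable: if a set Y of its
    elements is not contained in {1}, look at the first term S of the series
    that contains Y. The quotient of S by the preceding term is Z, so there is
    a homomorphism f : S -> Z that does not vanish on all of Y
    ([poly_infinite_cyclic_locally_indicable]). The proof applies this to the
    set Y of the ratios x y^-1 in G = G(X(A,B,I), r), where x and y are
    generators in the same piece A x B x {i} of X, and shows that f must vanish
    on Y. This is a contradiction, since Y contains a nontrivial element:
    x |-> sigma_x extends to a homomorphism from G to the symmetric group of X,
    and sigma_x depends on the B-component of x ([gen_inj_sigma]).

    Let N be the order of the symmetric group of X. As phi1(0) = 0, every
    sigma_x fixes x, and the defining relations then give
    x y^N = sigma_x(y)^N x: the group G permutes the powers y^N by conjugation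
    ([conj_gen_period]). Write v(x,y) = f(x^N y^-N). Conjugation by an element
    of S does not change f, so v(x,y) = v(pi x, pi y) for every permutation
    pi = sigma_p sigma_q^-1 with p q^-1 in Y. Hence
    v(x, pi^n x) = n v(x, pi x), and pi^N = 1 forces v(x, pi x) = 0
    ([power_ratio_shift]). The permutations pi connect any two points of
    A x B x {i}: the first coordinate is moved through another index j, as phi2
    is onto, and the second one by elements of phi1(A), which generate B. So v
    vanishes on all pairs of the same index ([power_ratio]).

    It remains to go from x^N y^-N to x y^-1. Generators with the same A- and
    I-components commute, so there f(x^N y^-N) = N f(x y^-1), and
    f(x y^-1) = 0 ([ratio_commuting]). In general x^N y^-N is a product of N
    factors x y_k^-1 up to ratios of this commuting kind, where y_k differs
    from y only in its B-component ([gen_ratioX_succ]); therefore again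
    0 = v(x,y) = N f(x y^-1) ([ratio_eq0]). *)

Set Implicit Arguments.
Unset Strict Implicit.
Unset Printing Implicit Defensive.

Import GRing.Theory Num.Theory.

Local Open Scope ring_scope.

(** * Integer powers in a group *)

Section IntegerPowers.
Variable G : groupType.
Implicit Types (g : G) (z : int).
Local Open Scope group_scope.

Definition expgz g z : G :=
  match z with Posz n => g ^+ n | Negz n => g ^- n.+1 end.

Lemma expgz_succ g z : expgz g (z + 1)%R = expgz g z * g.
Proof.
case: z => [n|[|n]].
- by rewrite -[(n%:Z + 1)%R]/(Posz (n + 1)) addn1 /= expgSr.
- by rewrite /= expg1 mulVg.
- have -> : (Negz n.+1 + 1)%R = Negz n by rewrite !NegzE -addn1 PoszD opprD addrNK.
  by rewrite /= [in RHS]expgS invgM mulgVK.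
Qed.

Lemma expgzD g z z' : expgz g (z + z')%R = expgz g z * expgz g z'.
Proof.
elim/int_rec: z' => [|n IHn|n IHn]; first by rewrite addr0 /= mulg1.
  by rewrite -addn1 PoszD addrA !expgz_succ IHn mulgA.
apply: (mulIg g); rewrite -mulgA -!expgz_succ -addrA.
by rewrite -addn1 PoszD opprD addrNK IHn.
Qed.

Lemma expgzN g z : expgz g (- z)%R = (expgz g z)^-1.
Proof. by apply/esym/mulg1_eq; rewrite -expgzD subrr. Qed.

End IntegerPowers.

(** * Local indicability of poly-(infinite cyclic) groups *)

Section LocalIndicability.
Variable G : groupType.
Implicit Types (g h k x y : G) (H K S Y : set G).
Local Open Scope group_scope.

Lemma is_subgroup1 H : is_subgroup H -> H 1.
Proof. by case=> /set_mem. Qed.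

Lemma is_subgroupF H x y : is_subgroup H -> H x -> H y -> H (x / y).
Proof. by case=> _ HF Hx Hy; apply/set_mem/HF; exact: mem_set. Qed.

Lemma is_subgroupV H x : is_subgroup H -> H x -> H x^-1.
Proof.
move=> sH Hx; rewrite -div1g; apply: is_subgroupF => //; exact: is_subgroup1.
Qed.

Lemma is_subgroupM H x y : is_subgroup H -> H x -> H y -> H (x * y).
Proof.
by move=> sH Hx Hy; rewrite -[y]invgK; apply: is_subgroupF => //; exact: is_subgroupV.
Qed.

Lemma is_subgroupX H x n : is_subgroup H -> H x -> H (x ^+ n).
Proof.
move=> sH Hx; elim: n => [|n IHn]; first exact: is_subgroup1.
by rewrite expgS; exact: is_subgroupM.
Qed.

Lemma is_subgroupXz H x z : is_subgroup H -> H x -> H (expgz x z).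
Proof.
by move=> sH Hx; case: z => n /=; [|apply: is_subgroupV => //]; exact: is_subgroupX.
Qed.

Lemma left_cosetMr K x k : is_subgroup K -> K k -> left_coset K (x * k) = left_coset K x.
Proof.
move=> sK Kk; apply/seteqP; split=> _ [h Kh <-].
  by exists (k * h); [exact: is_subgroupM|rewrite mulgA].
exists (k^-1 * h); last by rewrite -mulgA mulVKg.
by apply: is_subgroupM => //; exact: is_subgroupV.
Qed.

Lemma left_coset_rep K x y : is_subgroup K -> left_coset K x = left_coset K y ->
  exists2 k, K k & x = y * k.
Proof.
move=> sK eqxy; have: left_coset K x x.
  by exists 1; rewrite ?mulg1 //; exact: is_subgroup1.
by rewrite eqxy => -[k Kk <-]; exists k.
Qed.

(** The quotient is described by elements rather than by cosets: g generates
    S modulo K, and no nontrivial power of g lies in K, for otherwise there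
    would be finitely many cosets. *)
Lemma infinite_cyclic_quotient_gen K S : is_subgroup K -> is_subgroup S ->
  infinite_cyclic_quotient S K ->
  exists2 g, S g &
    (forall x, S x -> exists z, K ((expgz g z)^-1 * x)) /\
    (forall z, K (expgz g z) -> z = 0%R).
Proof.
move=> sK sS [inf [g Sg gen]]; exists g => //; split=> [x Sx|z Kz].
  have [|n] := gen (left_coset K x); first by exists x.
  case=> /(left_coset_rep sK)[k Kk ->].
    by exists n%:Z; rewrite /= mulKg.
  by exists (- n%:Z)%R; rewrite expgzN mulKg.
suff noper n : ~ K (g ^+ n.+1).
  case: z Kz => [[|n]|n] //= Kn; first by case: (noper n).
  by case: (noper n); rewrite -[_ ^+ _]invgK; exact: is_subgroupV.
move=> Kn; apply: inf.
apply: (@sub_finite_set _ _ [set left_coset K (g ^+ j) | j in `I_n.+1]%classic);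
  last exact/finite_image/finite_II.
(* exponents can be reduced modulo the positive exponent n.+1 *)
have pos m : [set left_coset K (g ^+ j) | j in `I_n.+1]%classic (left_coset K (g ^+ m)).
  exists (m %% n.+1)%N; first exact: ltn_pmod.
  rewrite [in RHS](divn_eq m n.+1) addnC expgnDr mulnC expgnA left_cosetMr //.
  exact: is_subgroupX.
move=> C /gen[m [->|->]]; first exact: pos.
have Km : K ((g ^+ n.+1) ^+ m) by exact: is_subgroupX.
(* a multiple of n.+1 is added to make the exponent nonnegative *)
by rewrite -(left_cosetMr (g ^- m) sK Km) -expgnA mulSn expgnDr mulKg; exact: pos.
Qed.

(** Homomorphisms from S to the integers are encoded as total functions, since
    the terms of a subnormal series are sets rather than types. *)
Definition additive_on S (f : G -> int) : Prop :=
  forall x y, S x -> S y -> f (x * y) = (f x + f y)%R.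

(** The homomorphism f is the exponent of the generator g in a factorisation
    x = g^(f x) k with k in K; it is additive because K is normal in S. *)
Lemma infinite_cyclic_quotient_additive K S : is_subgroup K -> is_subgroup S ->
  is_normal K S -> infinite_cyclic_quotient S K ->
  exists2 f, additive_on S f & forall x, S x -> f x = 0%R -> K x.
Proof.
move=> sK sS [KS nKS] /(infinite_cyclic_quotient_gen sK sS)[g Sg [ex inj]].
have /choice[f fP] : forall x, exists z, S x -> K ((expgz g z)^-1 * x).
  move=> x; have [/ex[z Kz]|nSx] := pselect (S x); first by exists z.
  by exists 0%R.
exists f => [x y Sx Sy|x /fP /[swap] ->]; last by rewrite invg1 mul1g.
have Sxy : S (x * y) by exact: is_subgroupM.
apply/eqP; rewrite eq_sym -subr_eq0; apply/eqP/inj.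
(* with x = g^(f x) k and y = g^(f y) k', the right-hand side is an explicit
   expression in conjugates of elements of K *)
have -> : expgz g (f x + f y - f (x * y)%g)%R =
    ((expgz g (f (x * y)))^-1 * (x * y)) /
    (((expgz g (f x))^-1 * x) ^ (expgz g (f y)) * ((expgz g (f y))^-1 * y)).
  rewrite addrC expgzD expgzN expgzD; move: (expgz _ _) (expgz _ _) (expgz _ _).
  move=> u v w; rewrite /conjg !invgM !invgK !mulgA.
  by rewrite !(mulgK, mulgVK).
apply: is_subgroupF; [by []|exact: fP|apply: is_subgroupM; [by []| |exact: fP]].
by apply: nKS; [exact: fP|exact: is_subgroupXz].
Qed.

(** The subgroup S is the first term of the series that contains Y, and f is
    the projection onto its quotient by the preceding term, which does not
    contain Y. *)
Lemma poly_infinite_cyclic_locally_indicable Y y0 : poly_infinite_cyclic G ->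
  Y y0 -> y0 <> 1 ->
  exists S f, [/\ is_subgroup S, (Y `<=` S)%classic, additive_on S f &
    exists2 y, Y y & f y <> 0%R].
Proof.
case=> m [S [S0 Sm sS step]] Yy0 y0N1.
have exi : exists i, `[< Y `<=` S i >]%classic by exists m; apply/asboolP; rewrite Sm.
case: (ex_minnP exi) => -[|i] /asboolP YS min.
  by case: y0N1; have := YS _ Yy0; rewrite S0.
have lim : (i < m)%N by apply: min; apply/asboolP; rewrite Sm.
have [nor cyc] := step i lim.
have [f fD f0] := infinite_cyclic_quotient_additive (sS _ (ltnW lim)) (sS _ lim) nor cyc.
exists (S i.+1), f; split=> //; first exact: sS.
apply: contrapT => none; suff: (i.+1 <= i)%N by rewrite ltnn.
apply: min; apply/asboolP => y Yy; apply: f0; first exact: YS.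
by apply: contrapT => fy; apply: none; exists y.
Qed.

End LocalIndicability.

Section AdditiveOn.
Variables (G : groupType) (S : set G) (f : G -> int).
Hypotheses (sS : is_subgroup S) (fM : additive_on S f).
Implicit Types x y : G.
Local Open Scope group_scope.

Lemma additive_on1 : f 1 = 0%R.
Proof.
have S1 := is_subgroup1 sS.
by apply: (addrI (f 1)); rewrite addr0 -fM // mulg1.
Qed.

Lemma additive_onV x : S x -> f x^-1 = (- f x)%R.
Proof.
move=> Sx; apply/eqP; rewrite -addr_eq0 -fM ?mulVg ?additive_on1 //.
exact: is_subgroupV.
Qed.

Lemma additive_onX x n : S x -> f (x ^+ n) = (f x *+ n)%R.
Proof.
move=> Sx; elim: n => [|n IHn]; first exact: additive_on1.
by rewrite expgS mulrS fM ?IHn //; exact: is_subgroupX.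
Qed.

Lemma additive_onJ x y : S x -> S y -> f (x ^ y) = f x.
Proof.
move=> Sx Sy; have SVy := is_subgroupV sS Sy.
rewrite /conjg !fM //; last exact: is_subgroupM.
by rewrite additive_onV // addrC addrK.
Qed.

End AdditiveOn.

(** * Generators of a structure group *)

Section StructureGroupGenerators.
Variables (X : choiceType) (r : X * X -> X * X).
Local Notation G := (structure_group r).
Local Open Scope group_scope.

Definition gen (x : X) : G :=
  (\pi_(presented_group (structure_rel r)) [:: (x, false)])%qT.

Lemma gen_rel x y z t : r (x, y) = (z, t) -> gen x * gen y = gen z * gen t.
Proof.
move=> rxy.
have genM u v : gen u * gen v =
    (\pi_(presented_group (structure_rel r)) [:: (u, false); (v, false)])%qT.
  by apply/pres_piP; apply: (pres_cat (u' := [:: _])); exact: repr_piP.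
by rewrite !genM; apply/pres_piP/pres_rel.
Qed.

Definition word_eval (H : groupType) (phi : X -> H) (w : word X) : H :=
  \prod_(l <- w) (if l.2 then (phi l.1)^-1 else phi l.1).

(** The universal property of the presentation, on words. *)
Lemma word_eval_pres_eq (H : groupType) (phi : X -> H) :
  (forall x y z t, r (x, y) = (z, t) -> phi x * phi y = phi z * phi t) ->
  forall u v, pres_eq (structure_rel r) u v -> word_eval phi u = word_eval phi v.
Proof.
move=> phi_rel u v; rewrite /word_eval; elim=> {u v}.
- by move=> _ _ [x y z t rxy]; rewrite !big_cons !big_nil /= !mulg1; exact: phi_rel.
- by case=> x []; rewrite !big_cons !big_nil /= mulg1 (mulVg, mulgV).
- by move=> u u' v v' _ IHu _ IHv; rewrite !big_cat IHu IHv.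
- by [].
- by [].
- by move=> u v w _ -> _ ->.
Qed.

(** Two generators can be told apart by any assignment that satisfies the
    relations. *)
Lemma gen_inj_morph (H : groupType) (phi : X -> H) x y :
  (forall x y z t, r (x, y) = (z, t) -> phi x * phi y = phi z * phi t) ->
  gen x = gen y -> phi x = phi y.
Proof.
move=> phi_rel /pres_piP /(word_eval_pres_eq phi_rel).
by rewrite /word_eval !big_seq1.
Qed.

Hypothesis r_sol : is_ybe_solution r.
Local Notation s x y := (r (x, y)).1.

(** The first component of the braid equation: sigma_x sigma_y =
    sigma_z sigma_t when r (x, y) = (z, t), so that x |-> sigma_x extends to an
    action of the structure group on X. *)
Lemma ybe_left_action x y w : s x (s y w) = s (s x y) (s (r (x, y)).2 w).
Proof.
have /= := ybe_braid r_sol (x, y, w); rewrite /r12 /r23 /=.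
case: (r (x, y)) => z t /=; case: (r (t, w)) => t' w' /=; case: (r (y, w)) => y' w'' /=.
by case: (r (z, t')) => a b; case: (r (x, y')) => c d /=; case: (r (d, w'')) => e g [].
Qed.

(** Moving x to the right past y^n. When every sigma_u fixes u, each step
    replaces a letter y by the same letter z = sigma_x(y): the relation
    x y = z t yields sigma_t(y) = z once more. The last condition keeps track
    of the letter that remains: it is obtained from x by applying sigma_z^-1
    n times. *)
Lemma gen_mulX x y n : (forall u, s u u = u) ->
  exists t, gen x * gen y ^+ n = gen (s x y) ^+ n * gen t /\
    s t y = s x y /\ iter n (fun v => s (s x y) v) t = x.
Proof.
move=> sqf; elim: n => [|n [t [IHgen [st it]]]].
  by exists x; rewrite mulg1 mul1g.
have [z [u rE]] : exists z u, r (t, y) = (z, u) by case: (r _) => z u; exists z, u.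
have zE : z = s x y by rewrite -st rE.
exists u; split.
  by rewrite !expgSr mulgA IHgen -!mulgA (gen_rel rE) zE.
have su : s z u = t by rewrite -rE (ybe_involutive r_sol).
split; last by rewrite iterSr -zE su zE.
rewrite -zE; apply: (bij_inj (ybe_left_bij r_sol z)) => /=.
have := ybe_left_action t y y; rewrite rE sqf /= => <-.
by rewrite sqf rE.
Qed.

End StructureGroupGenerators.

(** * Conjugation of powers in the structure group of X(A,B,I) *)

Section XABIStructureGroup.
Variables (A B : finZmodType) (I : finType).
Variables (phi1 : A -> B) (phi2 : {additive B -> A}).
Hypothesis phi1_even : forall a : A, phi1 (- a) = phi1 a.
Hypothesis phi1_0 : phi1 0 = 0.
Local Notation X := (XABI A B I).
Local Notation r := (@r_ABI A B I phi1 phi2).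
Local Notation s := (@sigma A B I phi1 phi2).
Local Notation gen := (@gen X r).
Implicit Types (a c : A) (b d : B) (i j : I) (x y p q : X).

Lemma sigmaE a b i c d j :
  s (a, b, i) (c, d, j) =
    if i == j then (c, d + phi1 (a - c), j) else (c + phi2 b, d, j).
Proof. by rewrite permE. Qed.

Lemma sigma_same a b c d i : s (a, b, i) (c, d, i) = (c, d + phi1 (a - c), i).
Proof. by rewrite sigmaE eqxx. Qed.

Lemma sigma_idx x y : (s x y).2 = y.2.
Proof. by case: x y => [[a b] i] [[c d] j]; rewrite sigmaE; case: ifP. Qed.

Lemma sigma_idxV x y : ((s x)^-1%g y).2 = y.2.
Proof. by rewrite -[in RHS](permKV (s x) y) sigma_idx. Qed.

Lemma sigma_diag x : s x x = x.
Proof. by case: x => [[a b] i]; rewrite sigma_same subrr phi1_0 addr0. Qed.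

(** The defining relation for two letters of the same index, where evenness of
    phi1 makes the corrections of the two second coordinates opposite. *)
Lemma gen_mul_same a b c d i :
  (gen (a, b, i) * gen (c, d, i) =
   gen (c, d + phi1 (a - c)%R, i)%R * gen (a, b - phi1 (a - c), i)%R)%g.
Proof.
apply: gen_rel; rewrite /r_ABI sigma_same; congr (_, _).
apply: (@perm_inj _ (s (c, d + phi1 (a - c), i))).
by rewrite permKV sigma_same -[c - a]opprB phi1_even subrK.
Qed.

(** Products of permutations are composed from left to right, hence the
    homomorphism to the symmetric group sends x to the inverse of sigma_x. *)
Lemma gen_inj_sigma x y : gen x = gen y -> s x = s y.
Proof.
pose phi u : {perm X} := ((s u)^-1)%g.
suff phi_rel u v z t : r (u, v) = (z, t) -> (phi u * phi v = phi z * phi t)%g.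
  by move=> /(gen_inj_morph phi_rel) /invg_inj.
move=> rE; rewrite /phi -!invMg; congr (_^-1)%g; apply/permP => w; rewrite !permM.
have := ybe_left_action (r_ABI_solution I phi2 phi1_even) u v w.
by rewrite rE /=; case: rE => ->.
Qed.

(** The exponent N of the introduction, common to all permutations of X, so
    that the N-th power of a generator acts trivially on X. *)
Definition period : nat := #|{perm X}|.

Lemma period_gt0 : (0 < period)%N.
Proof. by apply/card_gt0P; exists 1%g. Qed.

Lemma perm_period (p : {perm X}) : (p ^+ period = 1)%g.
Proof. by rewrite /period -cardsT expg_cardG ?inE. Qed.

Local Open Scope group_scope.

(** After exactly [period] steps of [gen_mulX] the remaining letter is x
    itself. *)
Lemma gen_mul_period x y : gen x * gen y ^+ period = gen (s x y) ^+ period * gen x.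
Proof.
have sol := r_ABI_solution I phi2 phi1_even.
have [u|t [-> [_ it]]] := gen_mulX sol x y period; first exact: sigma_diag.
congr (_ * gen _); rewrite -[LHS](perm1 t) -(perm_period (s (s x y))) permX.
exact: it.
Qed.

Lemma conj_gen_period x y : (gen y ^+ period) ^ (gen x)^-1 = gen (s x y) ^+ period.
Proof. by rewrite /conjg invgK mulgA gen_mul_period mulgK. Qed.

Lemma conj_gen_periodV x y :
  (gen y ^+ period) ^ (gen x) = gen ((s x)^-1 y) ^+ period.
Proof. by rewrite -{1}(permKV (s x) y) -conj_gen_period conjgKV. Qed.

(** In function notation the permutation is sigma_p sigma_q^-1. *)
Lemma conj_gen_ratio p q y : (gen y ^+ period) ^ (gen p / gen q)^-1 =
  gen (((s q)^-1 * s p) y) ^+ period.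
Proof.
by rewrite invgF conjgM conj_gen_periodV conj_gen_period permM.
Qed.

Lemma gen_commute a b d i : commute (gen (a, b, i)) (gen (a, d, i)).
Proof. by rewrite /commute gen_mul_same subrr phi1_0 addr0 subr0. Qed.

(** Moving y to the left past x^k: y is shifted by the same amount at each
    step, and each x is replaced by the same letter, because the shift
    depends on the A-components only. *)
Lemma genX_mul_same k a b c d i :
  gen (a, b, i) ^+ k * gen (c, d, i) =
  gen (c, d + phi1 (a - c) *+ k, i)%R * gen (a, b - phi1 (a - c), i)%R ^+ k.
Proof.
elim: k => [|k IHk]; first by rewrite mulr0n addr0 mul1g mulg1.
by rewrite !expgS -mulgA IHk mulgA gen_mul_same -mulgA -addrA -mulrSr.
Qed.

(** The left-hand side is x^k (x y^-1) x^-k times x^k y^-k. By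
    [genX_mul_same] the conjugate of y by x^k is a letter y' times
    x'^k x^-k, where x' commutes with x; this expresses the conjugate of
    x y^-1 by ratios of letters. *)
Lemma gen_ratioX_succ k a b c d i :
  gen (a, b, i) ^+ k.+1 / gen (c, d, i) ^+ k.+1 =
  (gen (a, b, i) / gen (a, b - phi1 (a - c), i)%R) ^+ k *
  (gen (a, b, i) / gen (c, d + phi1 (a - c) *+ k, i)%R) *
  (gen (a, b, i) ^+ k / gen (c, d, i) ^+ k).
Proof.
have := genX_mul_same k a b c d i.
set x := gen (a, b, i); set y := gen (c, d, i); set x' := gen (a, _, _).
set y' := gen (c, _, _) => yE.
have cxx' : commute x x' by exact: gen_commute.
have {yE}-> : y' = x ^+ k * y / x' ^+ k by rewrite yE mulgK.
rewrite (expgnFl _ cxx') !expgSr !invgM !invgK !mulgA mulgVK.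
by rewrite -[_ * x * x' ^+ k]mulgA (commuteX k cxx') mulgA mulgVK.
Qed.

(** * Homomorphisms to the integers vanish on ratios of generators *)

Definition orbit_ratios : set (structure_group r) :=
  [set g | exists p q, p.2 = q.2 /\ g = gen p / gen q]%classic.

Section VanishingHomomorphism.
Variables (S : set (structure_group r)) (f : structure_group r -> int).
Hypotheses (sS : is_subgroup S) (fM : additive_on S f).
Hypothesis ratioS : (orbit_ratios `<=` S)%classic.

Let S_ratio p q : p.2 = q.2 -> S (gen p / gen q).
Proof. by move=> pq; apply: ratioS; exists p, q. Qed.

(** The letters x and y need not lie in S, nor need x normalise S, so the
    factorisation [gen_ratioX_succ] into ratios of letters is what gives
    membership. *)
Lemma gen_ratioX_mem k x y : x.2 = y.2 -> S (gen x ^+ k / gen y ^+ k).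
Proof.
case: x y => [[a b] i] [[c d] j] /= <-; elim: k => [|k IHk].
  by rewrite divgg; exact: is_subgroup1.
rewrite gen_ratioX_succ; apply: is_subgroupM => //; apply: is_subgroupM => //.
  by apply: is_subgroupX => //; exact: S_ratio.
exact: S_ratio.
Qed.

Let v x y := f (gen x ^+ period / gen y ^+ period).

Let v_trans x y z : x.2 = y.2 -> y.2 = z.2 -> v x z = (v x y + v y z)%R.
Proof.
by move=> xy yz; rewrite /v -fM ?divgKA //; try exact: gen_ratioX_mem.
Qed.

Let v_refl x : v x x = 0%R.
Proof. by rewrite /v divgg (additive_on1 sS fM). Qed.

(** Conjugation by p q^-1 permutes the powers x^N as t does and preserves f, so
    n |-> v x (t^n x) is linear in n; it vanishes at n = [period]. *)
Lemma power_ratio_shift p q x : p.2 = q.2 -> v x (((s q)^-1 * s p) x) = 0%R.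
Proof.
move=> pq; set t := (s q)^-1 * s p.
have t2 y : (t y).2 = y.2 by rewrite permM sigma_idx sigma_idxV.
have vt y z : y.2 = z.2 -> v (t y) (t z) = v y z.
  move=> yz; rewrite /v -!conj_gen_ratio -conjVg -conjMg.
  rewrite (additive_onJ sS fM) //; first exact: gen_ratioX_mem.
  by apply: is_subgroupV => //; exact: S_ratio.
move: t t2 vt => t t2 vt.
have tX2 n y : ((t ^+ n) y).2 = y.2.
  by elim: n => [|n IHn]; rewrite ?perm1 // expgSr permM t2.
have vX n : v x ((t ^+ n) x) = (v x (t x) *+ n)%R.
  elim: n => [|n IHn]; first by rewrite perm1 v_refl.
  rewrite (v_trans (y := t x)) ?t2 ?tX2 // mulrS; congr (_ + _)%R.
  by rewrite expgSr permM vt ?tX2.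
have /esym/eqP := vX period.
by rewrite perm_period perm1 v_refl mulrn_eq0 gtn_eqF ?period_gt0 // => /eqP.
Qed.

Hypothesis I_gt1 : (1 < #|I|)%N.
Hypothesis phi2_surj : forall a, exists b, phi2 b = a.
Hypothesis phi1_gen : <<[set phi1 a | a : A]>> = [set: B].

(** The letters p = (0, d, j) and q = (0, 0, j) with j <> i give the
    translation of the first coordinate by phi2(d). *)
Lemma power_ratio_fst a c b i : v (a, b, i) (c, b, i) = 0%R.
Proof.
have [j ji] : exists j, j != i.
  have /card_gt1P[j [k [_ _ jk]]] := I_gt1.
  by have [<-|] := eqVneq j i; [exists k; rewrite eq_sym|exists j].
have [d dE] := phi2_surj (c - a)%R.
have := @power_ratio_shift (0, d, j)%R (0, 0, j)%R (a, b, i) erefl.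
have fixq : s (0, 0, j)%R (a, b, i) = (a, b, i).
  by rewrite sigmaE (negPf ji) raddf0 addr0.
by rewrite permM -{2}fixq permK sigmaE (negPf ji) dE addrC subrK.
Qed.

(** The letters p = (a + e, 0, i) and q = (a, 0, i) are chosen such that
    sigma_q fixes (a, b, i) and sigma_p adds phi1(e) to b. *)
Lemma power_ratio_snd_phi1 a e b i :
  v (a, b, i) (a, b + phi1 e, i)%R = 0%R.
Proof.
have := @power_ratio_shift (a + e, 0, i)%R (a, 0, i)%R (a, b, i) erefl.
have fixq : s (a, 0, i)%R (a, b, i) = (a, b, i).
  by rewrite sigma_same subrr phi1_0 addr0.
by rewrite permM -{2}fixq permK sigma_same [(a + e)%R]addrC addrK.
Qed.

Lemma power_ratio_snd a b d i : v (a, b, i) (a, d, i) = 0%R.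
Proof.
(* the translations of the second coordinate that preserve the vanishing of v
   form a subgroup, which contains phi1(A) *)
pose D := [set e | [forall u, v (a, u, i) (a, u + e, i)%R == 0%R]].
have gD : group_set D.
  apply/group_setP; split=> [|e e']; rewrite !inE.
    by apply/forallP => u; rewrite addr0 v_refl.
  move=> /forallP De /forallP De'; apply/forallP => u.
  by rewrite addrA (v_trans (y := (a, u + e, i)%R)) // (eqP (De _)) (eqP (De' _)).
have : <<[set phi1 e | e : A]>> \subset group gD.
  rewrite gen_subG; apply/fintype.subsetP => _ /imsetP[e _ ->]; rewrite inE.
  by apply/forallP => u; rewrite power_ratio_snd_phi1.
rewrite phi1_gen => /fintype.subsetP/(_ (d - b)%R).
rewrite !inE => /(_ isT)/forallP/(_ b).
by rewrite addrC subrK => /eqP.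
Qed.

Lemma power_ratio x y : x.2 = y.2 -> v x y = 0%R.
Proof.
case: x y => [[a b] i] [[c d] j] /= <-.
by rewrite (v_trans (y := (c, b, i))) // power_ratio_fst power_ratio_snd.
Qed.

(** For commuting x and y, x^N y^-N is the N-th power of x y^-1. *)
Lemma ratio_commuting a b d i : f (gen (a, b, i) / gen (a, d, i)) = 0%R.
Proof.
have := @power_ratio (a, b, i) (a, d, i) erefl.
rewrite /v -expgnFl; last exact: gen_commute.
rewrite (additive_onX sS fM); last exact: S_ratio.
by move/eqP; rewrite mulrn_eq0 gtn_eqF ?period_gt0 // => /eqP.
Qed.

Lemma ratio_indep_snd a b c d d' i :
  f (gen (a, b, i) / gen (c, d', i)) = f (gen (a, b, i) / gen (c, d, i)).
Proof.
rewrite -(divgKA (gen (c, d, i))) fM; try exact: S_ratio.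
by rewrite ratio_commuting addr0.
Qed.

(** By [gen_ratioX_succ] and [ratio_commuting], f(x^k y^-k) grows by f(x y^-1)
    with each step, and it is zero at k = [period]. *)
Lemma ratio_eq0 x y : x.2 = y.2 -> f (gen x / gen y) = 0%R.
Proof.
case: x y => [[a b] i] [[c d] j] /= <-.
suff fX k : f (gen (a, b, i) ^+ k / gen (c, d, i) ^+ k) =
    (f (gen (a, b, i) / gen (c, d, i)) *+ k)%R.
  have /esym/eqP := @power_ratio (a, b, i) (c, d, i) erefl.
  by rewrite /v fX eq_sym mulrn_eq0 gtn_eqF ?period_gt0 // => /eqP.
elim: k => [|k IHk]; first by rewrite divgg (additive_on1 sS fM).
have Sk := @gen_ratioX_mem k (a, b, i) (c, d, i) erefl.
have S1 : S (gen (a, b, i) / gen (a, b - phi1 (a - c), i)%R) by exact: S_ratio.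
have S2 : S (gen (a, b, i) / gen (c, d + phi1 (a - c) *+ k, i)%R) by exact: S_ratio.
have S1k := is_subgroupX k sS S1.
have S12 := is_subgroupM sS S1k S2.
rewrite gen_ratioX_succ (fM S12 Sk) (fM S1k S2).
rewrite (additive_onX sS fM _ S1) ratio_commuting mul0rn add0r.
by rewrite (ratio_indep_snd _ _ _ d) IHk mulrS.
Qed.

End VanishingHomomorphism.

End XABIStructureGroup.

(** * The structure group is not poly-(infinite cyclic) *)

Theorem theorem4p4 (A B : finZmodType) (I : finType)
    (phi1 : A -> B) (phi2 : {additive B -> A}) :
  (1 < #|A|)%N -> (1 < #|B|)%N -> (1 < #|I|)%N ->
  (forall a : A, phi1 (- a) = phi1 a) ->
  phi1 0 = 0 ->
  <<[set phi1 a | a : A]>>%g = [set: B] ->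
  bijective phi2 ->
  ~ poly_infinite_cyclic (structure_group (@r_ABI A B I phi1 phi2)).
Proof.
move=> _ B_gt1 I_gt1 even phi1_0 gen1 [psi phi2K psiK] poly.
have [b b0] : exists b : B, b != 0.
  have /card_gt1P[b [d [_ _ bd]]] := B_gt1.
  by have [d0|] := eqVneq d 0; [exists b; rewrite -d0|exists d].
have /card_gt1P[i [j [_ _ ij]]] := I_gt1.
pose x d : XABI A B I := (0, d, i).
pose w := (gen (@r_ABI A B I phi1 phi2) (x b) / gen (@r_ABI A B I phi1 phi2) (x 0))%g.
have w1 : w <> 1%g.
  (* sigma_(x b) moves (0, 0, j) by phi2(b), whereas sigma_(x 0) fixes it *)
  move=> /divg1_eq /(gen_inj_sigma even) /permP/(_ (0, 0, j)).
  rewrite !sigmaE (negPf ij) raddf0 addr0 add0r => -[phi2b].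
  by case/eqP: b0; apply: (can_inj phi2K); rewrite phi2b raddf0.
have orbw : orbit_ratios w by exists (x b), (x 0).
have [S [f [sS YS fM]]] := poly_infinite_cyclic_locally_indicable poly orbw w1.
case=> y [p [q [pq ->]]]; apply; apply: (ratio_eq0 even phi1_0 sS fM YS) => //.
by move=> a; exists (psi a).
Qed.
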